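(* Let $\lambda$ be a nonzero real number and let $x\in\mathbb{R}$. For every integer $n\ge 0$, $$\beta_{n,\lambda}(x)=\sum_{m=0}^{n}D_{m,\lambda}(x)\,S_{2,\lambda}(n,m).$$
   Context: Generating functions are power series in $t$ (formal, or convergent for $|t|$ small), with $(1+t)^{x}=\sum_{n\ge 0}(x)_n\frac{t^n}{n!}$, where $(x)_0=1$ and $(x)_n=x(x-1)\cdots(x-n+1)$ for $n\ge1$. Also $(x)_{0,\lambda}=1$ and $(x)_{n,\lambda}=x(x-\lambda)\cdots(x-(n-1)\lambda)$ for $n\ge 1$, and $(1+\lambda t)^{x/\lambda}=\sum_{n\ge0}(x)_{n,\lambda}\frac{t^n}{n!}$. The degenerate logarithm is $\log_\lambda(1+t)=\frac{1}{\lambda}\left((1+t)^\lambda-1\right)$. The degenerate Daehee polynomials $D_{n,\lambda}(x)$ are defined by $\frac{\log_\lambda(1+t)}{t}(1+t)^x=\sum_{n=0}^\infty D_{n,\lambda}(x)\frac{t^n}{n!}$. The degenerate Bernoulli polynomials $\beta_{n,\lambda}(x)$ are defined by $\frac{t}{(1+\lambda t)^{1/\lambda}-1}(1+\lambda t)^{x/\lambda}=\sum_{n=0}^\infty \beta_{n,\lambda}(x)\frac{t^n}{n!}$. The degenerate Stirling numbers of the second kind $S_{2,\lambda}(n,l)$ are defined by the polynomial identity in $x$: $(x)_{n,\lambda}=\sum_{l=0}^n S_{2,\lambda}(n,l)(x)_l$ for $n\ge0$. *)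

(* Defs.v *)
From HB Require Import structures.
From mathcomp Require Import all_boot all_order all_algebra.
From mathcomp Require Import ring.
From mathcomp Require Import boolp classical_sets reals.

Set Implicit Arguments.
Unset Strict Implicit.
Unset Printing Implicit Defensive.

Import Order.TTheory GRing.Theory Num.Theory.
Local Open Scope ring_scope.

Record fps (R : Type) := Fps { fcoef : nat -> R }.

Notation "f `[ n ]" := (fcoef f n)
  (at level 2, left associativity, format "f `[ n ]") : ring_scope.

HB.instance Definition _ (R : Type) := gen_eqMixin (fps R).
HB.instance Definition _ (R : Type) := gen_choiceMixin (fps R).

Lemma fpsP (R : Type) (f g : fps R) : (forall n, f`[n] = g`[n]) -> f = g.
Proof. by case: f g => [f] [g] /= fg; congr Fps; apply: funext. Qed.

Section FpsRing.
Variable R : comNzRingType.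
Implicit Types f g h : fps R.

Definition fps_zero : fps R := Fps (fun=> 0).
Definition fps_opp f : fps R := Fps (fun n => - f`[n]).
Definition fps_add f g : fps R := Fps (fun n => f`[n] + g`[n]).
Definition fpsC (c : R) : fps R := Fps (fun n => if n == 0%N then c else 0).
Definition fps_mul f g : fps R :=
  Fps (fun n => \sum_(i < n.+1) f`[i] * g`[n - i]).

Lemma fps_addA : associative fps_add.
Proof. by move=> f g h; apply: fpsP => n /=; rewrite addrA. Qed.
Lemma fps_addC : commutative fps_add.
Proof. by move=> f g; apply: fpsP => n /=; rewrite addrC. Qed.
Lemma fps_add0 : left_id fps_zero fps_add.
Proof. by move=> f; apply: fpsP => n /=; rewrite add0r. Qed.
Lemma fps_addN : left_inverse fps_zero fps_opp fps_add.
Proof. by move=> f; apply: fpsP => n /=; rewrite addNr. Qed.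

HB.instance Definition _ :=
  GRing.isZmodule.Build (fps R) fps_addA fps_addC fps_add0 fps_addN.

Definition fps_trunc (N : nat) f : {poly R} := \poly_(i < N) f`[i].

Lemma fps_mul_trunc f g n N : (n < N)%N ->
  (fps_mul f g)`[n] = (fps_trunc N f * fps_trunc N g)`_n.
Proof.
move=> nN; rewrite coefM /=; apply: eq_bigr => i _.
have iN : (i < N)%N by apply: leq_trans nN; rewrite ltnS -ltnS ltn_ord.
by rewrite !coef_poly iN (leq_ltn_trans (leq_subr _ _) nN).
Qed.

Lemma fps_mulC : commutative fps_mul.
Proof. by move=> f g; apply: fpsP => n; rewrite !(fps_mul_trunc _ _ (ltnSn n)) mulrC. Qed.

Lemma coefM_low (p p' q : {poly R}) n :
  (forall i, (i <= n)%N -> p`_i = p'`_i) -> (p * q)`_n = (p' * q)`_n.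
Proof.
move=> pp'; rewrite !coefM; apply: eq_bigr => i _.
by rewrite pp' // -ltnS ltn_ord.
Qed.

Lemma fps_mulA : associative fps_mul.
Proof.
move=> f g h; apply: fpsP => n; rewrite !(fps_mul_trunc _ _ (ltnSn n)).
have low u v i : (i <= n)%N ->
    (fps_trunc n.+1 (fps_mul u v))`_i
    = (fps_trunc n.+1 u * fps_trunc n.+1 v)`_i.
  by move=> ile; rewrite coef_poly ltnS ile; apply: fps_mul_trunc.
rewrite (coefM_low _ (low f g)) mulrC (coefM_low _ (low g h)).
by rewrite mulrC mulrA.
Qed.

Lemma fps_mul1 : left_id (fpsC 1) fps_mul.
Proof.
move=> f; apply: fpsP => n /=; rewrite big_ord_recl /= mul1r subn0.
by rewrite big1 ?addr0 // => i _; rewrite mul0r.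
Qed.

Lemma fps_mulDl : left_distributive fps_mul fps_add.
Proof.
move=> f g h; apply: fpsP => n /=; rewrite -big_split /=.
by apply: eq_bigr => i _; rewrite mulrDl.
Qed.

Lemma fps_one_neq0 : fpsC 1 != 0 :> fps R.
Proof. by apply/eqP => /(congr1 (fun f => f`[0])) /= /eqP; rewrite oner_eq0. Qed.

HB.instance Definition _ := GRing.Zmodule_isComNzRing.Build (fps R)
  fps_mulA fps_mulC fps_mul1 fps_mulDl fps_one_neq0.

Definition fpsX : fps R := Fps (fun n => if n == 1%N then 1 else 0).

Lemma fcoefXM f n : (fpsX * f)`[n] = if n is m.+1 then f`[m] else 0.
Proof.
rewrite /GRing.mul /=; case: n => [|n]; first by rewrite big_ord1 mul0r.
rewrite big_ord_recl mul0r add0r big_ord_recl /= mul1r big1 ?addr0; last first.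
  by move=> i _; rewrite mul0r.
by rewrite subSS subn0.
Qed.

End FpsRing.

Arguments fpsX {R}.

(* [fps_quot f g] is the series [h] with [h * g = f].  It is unique when
   [g != 0] ([fps_quotP]), even when [g`[0] = 0], so that [g] is not a unit;
   it is meaningful only when such an [h] exists. *)
Definition fps_quot (F : fieldType) (f g : fps F) : fps F :=
  xget 0 [set h | h * g = f].

Section FpsField.
Variable F : fieldType.
Implicit Types f g h : fps F.

Lemma fps_mul_eq0 f g : f * g = 0 -> g != 0 -> f = 0.
Proof.
move=> fg0 g0; apply: contrapT => f0.
have nz (h : fps F) : h <> 0 -> exists n, h`[n] != 0.
  move=> h0; apply: contrapT => hn; apply: h0; apply: fpsP => n.
  by apply/eqP; apply: contrapT => /negP hn'; apply: hn; exists n.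
have [i fi mini] := ex_minnP (nz _ f0).
have [j gj minj] := ex_minnP (nz _ (elimN eqP g0)).
have := congr1 (fun h => h`[i + j]) fg0; rewrite /GRing.mul /=.
have ilt : (i < (i + j).+1)%N by rewrite ltnS leq_addr.
rewrite (bigD1 (Ordinal ilt)) //= addKn big1 ?addr0.
  by move/eqP; rewrite mulf_eq0 (negPf fi) (negPf gj).
move=> k; rewrite -val_eqE /= neq_ltn => /orP[ki|ik].
  have [->|/mini] := eqVneq (f`[k]) 0; first by rewrite mul0r.
  by rewrite leqNgt ki.
have [->|/minj] := eqVneq (g`[i + j - k]) 0; first by rewrite mulr0.
have kij : (k <= i + j)%N by rewrite -ltnS.
by rewrite leq_subRL // leq_add2r leqNgt ik.
Qed.

Lemma fps_quotP f g h : g != 0 -> h * g = f -> fps_quot f g = h.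
Proof.
move=> g0 hg; rewrite /fps_quot; case: xgetP => [k _ /= kg|/(_ h)//].
apply/eqP; rewrite -subr_eq0; apply/eqP.
by apply: (@fps_mul_eq0 _ g) => //; rewrite mulrBl kg hg subrr.
Qed.

Lemma fps_inv_exists f : f`[0] != 0 -> exists h, h * f = 1.
Proof.
move=> f0.
pose step (s : seq F) :=
  rcons s (((size s == 0%N)%:R - \sum_(i < size s) s`_i * f`[size s - i]) / f`[0]).
pose s n := iter n step [::].
have szs n : size (s n) = n by elim: n => //= n IH; rewrite size_rcons IH.
have nths n m : (n < m)%N -> (s m)`_n = (s n.+1)`_n.
  elim: m => // m IH; rewrite ltnS leq_eqVlt => /orP[/eqP->//|nm].
  by rewrite -IH //= nth_rcons szs nm.
exists (Fps (fun n => (s n.+1)`_n)); apply: fpsP => n.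
rewrite {1}/GRing.mul /= big_ord_recr /= subnn.
rewrite [(step (s n))`_n]nth_rcons szs ltnn eqxx divfK //.
under [X in X + _]eq_bigr => i _ do rewrite -(@nths i n) ?ltn_ord //.
by rewrite addrC subrK; case: n.
Qed.

End FpsField.

Definition ffact (A : comNzRingType) (x : A) (n : nat) : A :=
  \prod_(i < n) (x - i%:R).

Definition dffact (A : comNzRingType) (lam x : A) (n : nat) : A :=
  \prod_(i < n) (x - i%:R * lam).

(* (1 + a t)^y as a series in t; (1 + lam t)^(x / lam) is the case
   [a := lam], [y := x / lam], see [fps_binom_dffact]. *)
Definition fps_binom (F : fieldType) (a y : F) : fps F :=
  Fps (fun n => ffact y n * a ^+ n / n`!%:R).

(* The series in t of log_lam (1 + t), not of log_lam t. *)
Definition deg_log (F : fieldType) (lam : F) : fps F :=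
  fpsC lam^-1 * (fps_binom 1 lam - 1).

Definition egf_coef (F : fieldType) (f : fps F) (n : nat) : F :=
  n`!%:R * f`[n].

Definition deg_daehee (F : fieldType) (lam x : F) : nat -> F :=
  egf_coef (fps_quot (deg_log lam) fpsX * fps_binom 1 x).

Definition deg_bernoulli (F : fieldType) (lam x : F) : nat -> F :=
  egf_coef (fps_quot fpsX (fps_binom lam lam^-1 - 1) * fps_binom lam (x / lam)).

(* The identity is between polynomials in the indeterminate 'X; the values
   [S n l] with [l > n] are unconstrained. *)
Definition is_deg_stirling2 (F : fieldType) (lam : F) (S : nat -> nat -> F) :=
  forall n, dffact lam%:P 'X n = \sum_(l < n.+1) S n l *: ffact 'X l.

Lemma fps_binom_dffact (F : fieldType) (lam x : F) n : lam != 0 ->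
  (fps_binom lam (x / lam))`[n] = dffact lam x n / n`!%:R.
Proof.
move=> l0; congr (_ / _); rewrite /ffact /dffact -[in lam ^+ n](card_ord n).
rewrite -prodr_const -big_split /=; apply: eq_bigr => i _.
by rewrite mulrBl divfK.
Qed.

Lemma fpsX_neq0 (F : fieldType) : fpsX != 0 :> fps F.
Proof. by apply/eqP => /(congr1 (fun f => f`[1])) /= /eqP; rewrite oner_eq0. Qed.

Lemma fps_binom0 (F : fieldType) (a y : F) : (fps_binom a y)`[0] = 1.
Proof. by rewrite /= /ffact big_ord0 expr0 mulr1 fact0 divr1. Qed.

Lemma fps_binom1 (F : fieldType) (a y : F) : (fps_binom a y)`[1] = y * a.
Proof. by rewrite /= /ffact big_ord1 expr1 subr0 divr1. Qed.

Lemma deg_daehee_quotK (F : fieldType) (lam : F) :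
  fps_quot (deg_log lam) fpsX * fpsX = deg_log lam.
Proof.
set h := Fps (fun n => (deg_log lam)`[n.+1]).
suff hX : h * fpsX = deg_log lam by rewrite (fps_quotP (fpsX_neq0 F) hX).
apply: fpsP => n; rewrite mulrC fcoefXM; case: n => //.
rewrite /deg_log /GRing.mul /= big_ord1 -/(fps_binom 1 lam).
by rewrite -[X in _ = _ * (X - _)]/((fps_binom 1 lam)`[0]) fps_binom0 subrr mulr0.
Qed.

Lemma deg_bernoulli_quotK (F : fieldType) (lam : F) : lam != 0 ->
  let g := fps_binom lam lam^-1 - 1 in fps_quot fpsX g * g = fpsX.
Proof.
move=> l0 g; pose k := Fps (fun n => g`[n.+1]).
have g0 : g`[0] = 0.
  by rewrite -[LHS]/((fps_binom lam lam^-1)`[0] - 1) fps_binom0 subrr.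
have g1 : g`[1] = 1.
  by rewrite -[LHS]/((fps_binom lam lam^-1)`[1] - 0) fps_binom1 subr0 mulVf.
have gE : g = fpsX * k by apply: fpsP => -[|n]; rewrite fcoefXM.
have [|h hk] := @fps_inv_exists F k; first by rewrite -[k`[0]]/(g`[1]) g1 oner_neq0.
have gn0 : g != 0.
  by apply/eqP => g_eq0; move/eqP: g1; rewrite g_eq0 eq_sym oner_eq0.
have hg : h * g = fpsX by rewrite gE mulrCA hk mulr1.
by rewrite (fps_quotP gn0 hg).
Qed.

Lemma is_deg_stirling2_exists (F : fieldType) (lam : F) :
  exists S, is_deg_stirling2 lam S.
Proof.
suff H n : exists s : nat -> F,
    dffact lam%:P 'X n = \sum_(l < n.+1) s l *: ffact 'X l.
  by exists (fun n => projT1 (cid (H n))) => n; case: (cid (H n)).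
elim: n => [|n [s IH]].
  by exists (fun=> 1); rewrite big_ord1 scale1r /dffact /ffact !big_ord0.
exists (fun l => (if (l <= n)%N then (l%:R - n%:R * lam) * s l else 0)
                 + (if l is m.+1 then s m else 0)).
under eq_bigr do rewrite scalerDl.
rewrite big_split /= [X in X + _]big_ord_recr /= ltnn scale0r addr0.
rewrite [X in _ + X]big_ord_recl scale0r add0r -big_split /=.
rewrite /dffact big_ord_recr -/(dffact _ _ _) /= IH mulr_suml.
apply: eq_bigr => i _; rewrite -ltnS ltn_ord.
rewrite /bump /= add1n /ffact big_ord_recr /= -/(ffact _ _).
rewrite -!mul_polyC polyCM polyCB !polyCM !polyC_natr.
rewrite -[_ %:P * _ * _]mulrA.
ring.
Qed.

(* Main.v *)
Require Import Defs.
From mathcomp Require Import all_boot all_order all_algebra.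
From mathcomp Require Import reals.
From mathcomp Require Import ring.

(** Put [g = (1 + lam t)^(1/lam) - 1], a series without constant term.  Then
    [log_lam (1 + g) = t], so substituting [g] for [t] in the generating
    function [log_lam (1 + t) / t * (1 + t)^x] of the Daehee polynomials gives
    [t / g * (1 + lam t)^(x/lam)], the generating function of the Bernoulli
    polynomials ([fps_comp_daehee]).  On the other hand [S2 n m] is the
    coefficient of [t^n / n!] in [g^m / m!] ([stirling2_egf]), so substituting
    [g] acts on exponential coefficients as the matrix [S2]
    ([egf_coef_comp]).  Comparing the two gives the theorem.

    The formula for [S2] is obtained by expanding [(1 + lam t)^(k/lam)], that
    is [(1 + g)^k], for natural numbers [k]: it is a combination of falling
    factorials [(k)_m], with coefficients [S2 n m] by definition and with
    coefficients read off from [g^m] by the binomial theorem.  Values at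
    natural numbers determine such coefficients ([ffact_sum_inj]).

    That substitution is multiplicative is used only for a factor [t], where
    it is a plain reindexing ([fps_compXM]).  This suffices: multiplying the
    Daehee series by [t] leaves [log_lam (1 + t) * (1 + t)^x], which is
    [((1 + t)^(x + lam) - (1 + t)^x) / lam], and the effect of substitution on
    a binomial series [(1 + t)^y] is exactly the defining identity of [S2],
    evaluated at [y] ([fps_comp_binom]). *)

Set Implicit Arguments.
Unset Strict Implicit.
Unset Printing Implicit Defensive.

Import Order.TTheory GRing.Theory Num.Theory.
Local Open Scope ring_scope.

(** * Substitution in formal power series *)

Section Composition.
Variable R : comNzRingType.
Implicit Types f g h : fps R.

Lemma fcoefM f g n : (f * g)`[n] = \sum_(i < n.+1) f`[i] * g`[n - i].
Proof. by []. Qed.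

Lemma fcoefCM (c : R) f n : (fpsC c * f)`[n] = c * f`[n].
Proof.
rewrite fcoefM big_ord_recl /= subn0 big1 ?addr0 // => i _.
by rewrite mul0r.
Qed.

Lemma fcoef_sum (I : Type) (r : seq I) (F : I -> fps R) n :
  (\sum_(i <- r) F i)`[n] = \sum_(i <- r) (F i)`[n].
Proof. exact: (big_morph (fun f => f`[n])). Qed.

Lemma fcoefMn f k n : (f *+ k)`[n] = f`[n] *+ k.
Proof. by elim: k => [|k IH] //; rewrite !mulrS -IH. Qed.

Lemma fcoef_exp_gt g m n : g`[0] = 0 -> (n < m)%N -> (g ^+ m)`[n] = 0.
Proof.
move=> g0; elim: m n => // m IH n; rewrite ltnS => nm.
rewrite exprS fcoefM big_ord_recl g0 mul0r add0r big1 // => i _ /=.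
rewrite IH ?mulr0 //; case: n nm i => [_ []//|n nm i].
by rewrite subSS (leq_ltn_trans (leq_subr _ _)).
Qed.

(** The series [f(g(t))], meant for [g`[0] = 0]: then [g ^+ m] has order at
    least [m], so the terms with [m > n] do not contribute to the [n]-th
    coefficient. *)
Definition fps_comp f g : fps R :=
  Fps (fun n => \sum_(m < n.+1) f`[m] * (g ^+ m)`[n]).

Lemma fps_compE f g n :
  (fps_comp f g)`[n] = \sum_(m < n.+1) f`[m] * (g ^+ m)`[n].
Proof. by []. Qed.

Lemma fps_comp_widen f g n N : g`[0] = 0 -> (n <= N)%N ->
  (fps_comp f g)`[n] = \sum_(m < N.+1) f`[m] * (g ^+ m)`[n].
Proof.
move=> g0 nN; rewrite /= (big_ord_widen N.+1 (fun m => f`[m] * (g ^+ m)`[n])) //.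
rewrite big_mkcond; apply: eq_bigr => m _; case: ltnP => // nm.
by rewrite fcoef_exp_gt ?mulr0.
Qed.

Lemma fps_compB f h g : fps_comp (f - h) g = fps_comp f g - fps_comp h g.
Proof.
apply: fpsP => n; rewrite -[RHS]/((fps_comp f g)`[n] - (fps_comp h g)`[n]) !fps_compE.
by rewrite -sumrB; apply: eq_bigr => m _; rewrite mulrBl.
Qed.

Lemma fps_compCM (c : R) f g : fps_comp (fpsC c * f) g = fpsC c * fps_comp f g.
Proof.
apply: fpsP => n; rewrite fcoefCM !fps_compE mulr_sumr.
by apply: eq_bigr => m _; rewrite fcoefCM mulrA.
Qed.

(** Substitution maps [t^m] to [g^m], and multiplying by [t] shifts [m]. *)
Lemma fps_compXM f g : g`[0] = 0 ->
  fps_comp (fpsX * f) g = g * fps_comp f g.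
Proof.
move=> g0; apply: fpsP => n; rewrite fcoefM.
transitivity (\sum_(m < n.+1) f`[m] * (g ^+ m.+1)`[n]); last first.
  under [RHS]eq_bigr => i _ do
    rewrite (fps_comp_widen _ g0 (leq_subr i n)) mulr_sumr.
  rewrite exchange_big; apply: eq_bigr => m _.
  rewrite exprS fcoefM mulr_sumr; apply: eq_bigr => i _.
  by rewrite mulrCA.
(* The top term vanishes since [g ^+ n.+1] has order at least [n.+1]. *)
rewrite [RHS]big_ord_recr [RHS]/= fcoef_exp_gt // mulr0 addr0.
rewrite fps_compE big_ord_recl fcoefXM mul0r add0r.
by apply: eq_bigr => m _; rewrite fcoefXM.
Qed.

End Composition.

(** * Falling factorials and binomial series *)

Lemma ffact_natr (A : comNzRingType) k m : ffact (k%:R : A) m = (k ^_ m)%:R.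
Proof.
elim: m => [|m IH]; first by rewrite /ffact big_ord0.
rewrite /ffact big_ord_recr /= -/(ffact _ _) IH ffactnSr natrM.
have [mk|km] := leqP m k; first by rewrite natrB.
by rewrite ffact_small // !mul0r.
Qed.

Section Binomial.
Variable F : numFieldType.

Lemma fact_neq0 n : n`!%:R != 0 :> F.
Proof. by rewrite pnatr_eq0 -lt0n fact_gt0. Qed.

(** The matrix of the values [(k)_m] at natural numbers [k] is triangular with
    the nonzero diagonal entries [m!], so it can be inverted row by row. *)
Lemma ffact_sum_inj N (c d : nat -> F) :
    (forall k, \sum_(m < N) c m * ffact k%:R m
             = \sum_(m < N) d m * ffact k%:R m) ->
  forall m, (m < N)%N -> c m = d m.
Proof.
move=> cd; elim/ltn_ind=> m IH mN; move: (cd m).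
rewrite (bigD1 (Ordinal mN)) //= [in X in _ = X](bigD1 (Ordinal mN)) //=.
rewrite (_ : \sum_(i < N | _) c _ * _
  = \sum_(i < N | i != Ordinal mN) d i * ffact m%:R i); last first.
  apply: eq_bigr => i; rewrite -val_eqE /= neq_ltn => /orP[im|mi].
    by rewrite IH.
  by rewrite ffact_natr ffact_small // !mulr0.
by move/addIr; rewrite ffact_natr ffactnn; apply: mulIf; apply: fact_neq0.
Qed.

(** The differential equation [(1 + a t) f' = a y f] of [f = (1 + a t)^y],
    read on coefficients. *)
Lemma fps_binomS (a y : F) n :
  n.+1%:R * (fps_binom a y)`[n.+1] = a * (y - n%:R) * (fps_binom a y)`[n].
Proof.
rewrite /= /ffact big_ord_recr /= exprS factS natrM.
have := fact_neq0 n; have : n.+1%:R != 0 :> F by rewrite pnatr_eq0.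
move: n.+1%:R n`!%:R => u v u0 v0.
by field; rewrite u0 v0.
Qed.

(** Both sides satisfy the first-order recurrence [fps_binomS] for the exponent
    [y + z]; for the product this is the Leibniz rule. *)
Lemma fps_binomD (a y z : F) :
  fps_binom a (y + z) = fps_binom a y * fps_binom a z.
Proof.
apply: fpsP; elim=> [|n IH]; first by rewrite fcoefM big_ord1 !fps_binom0 mulr1.
have n0 : n.+1%:R != 0 :> F by rewrite pnatr_eq0.
apply: (mulfI n0); rewrite fps_binomS IH !fcoefM mulr_sumr [RHS]mulr_sumr.
move: (fps_binom a y) (fps_binom a z) (fps_binomS a y) (fps_binomS a z).
move=> b c bS cS.
(* The factor [n.+1] is split as [i + (n.+1 - i)], which differentiates one
   factor of the product in each sum. *)
transitivity (\sum_(i < n.+2) (i%:R * b`[i]) * c`[n.+1 - i]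
            + \sum_(i < n.+2) b`[i] * ((n.+1 - i)%:R * c`[n.+1 - i])); last first.
  rewrite -big_split; apply: eq_bigr => i _ /=.
  by rewrite natrB -1?ltnS //; ring.
rewrite [X in _ = X + _]big_ord_recl [X in _ = _ + X]big_ord_recr /=.
rewrite !mul0r add0r subnn mul0r mulr0 addr0 -big_split.
apply: eq_bigr => i _ /=.
have le_in : (i <= n)%N by rewrite -ltnS.
rewrite /bump add1n subSS subSn // bS cS natrB //.
ring.
Qed.

Lemma fps_binomMn (a y : F) k : fps_binom a (k%:R * y) = fps_binom a y ^+ k.
Proof.
elim: k => [|k IH]; last by rewrite exprS -IH -fps_binomD mulrSr mulrDl mul1r addrC.
apply: fpsP => -[|n]; first by rewrite mul0r fps_binom0.
by rewrite /= mul0r /ffact big_ord_recl subrr !mul0r.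
Qed.

Lemma fps_binom_1 (a : F) : fps_binom a 1 = 1 + fpsC a * fpsX.
Proof.
apply: fpsP => n; rewrite -[RHS]/((1 : fps F)`[n] + (fpsC a * fpsX)`[n]) fcoefCM.
case: n => [|[|n]]; first by rewrite fps_binom0 mulr0 addr0.
  by rewrite fps_binom1 add0r mulrC.
rewrite [RHS]/= mulr0 addr0 [LHS]/=.
suff -> : ffact (1 : F) n.+2 = 0 by rewrite !mul0r.
by rewrite -[1]/(1%:R) ffact_natr ffact_small.
Qed.

End Binomial.

(** * Stirling numbers as coefficients of a substitution *)

Section Stirling.
Variables (F : numFieldType) (lam : F) (S2 : nat -> nat -> F).
Hypotheses (lam0 : lam != 0) (hS2 : is_deg_stirling2 lam S2).

Let g := fps_binom lam lam^-1 - 1.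

Lemma deg_exp_coef0 : g`[0] = 0.
Proof. by rewrite -[LHS]/((fps_binom lam lam^-1)`[0] - 1) fps_binom0 subrr. Qed.

Lemma deg_exp_neq0 : g != 0.
Proof.
apply/eqP => /(congr1 (fun f => f`[1])).
rewrite -[LHS]/((fps_binom lam lam^-1)`[1] - 0) fps_binom1 subr0 mulVf //.
by move/eqP; rewrite oner_eq0.
Qed.

Lemma dffact_stirling2 (y : F) n :
  dffact lam y n = \sum_(l < n.+1) S2 n l * ffact y l.
Proof.
have := congr1 (horner_eval y) (hS2 n).
rewrite raddf_sum /dffact rmorph_prod /= => E.
transitivity (\prod_(i < n) horner_eval y ('X - i%:R * lam%:P)).
  by apply: eq_bigr => i _; rewrite /horner_eval -polyC_natr !hornerE.
rewrite E; apply: eq_bigr => l _.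
rewrite /horner_eval hornerZ /ffact horner_prod; congr (_ * _).
by apply: eq_bigr => i _; rewrite -polyC_natr !hornerE.
Qed.

(** The two expansions of [(1 + lam t)^(k/lam) = (1 + g)^k] in falling
    factorials of [k] have the same coefficients.  The bound [m <= n] is
    essential, because [is_deg_stirling2] leaves [S2 n m] free for [m > n]. *)
Lemma stirling2_egf n m : (m <= n)%N ->
  m`!%:R * S2 n m = n`!%:R * (g ^+ m)`[n].
Proof.
move=> mn; have m0 := fact_neq0 F m.
suff -> : S2 n m = n`!%:R * (g ^+ m)`[n] / m`!%:R by rewrite mulrC divfK.
apply: (@ffact_sum_inj _ n.+1 (S2 n)
  (fun m => n`!%:R * (g ^+ m)`[n] / m`!%:R)) mn => k.
rewrite -dffact_stirling2.
have -> : dffact lam k%:R n = n`!%:R * ((1 + g) ^+ k)`[n].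
  rewrite /g addrC subrK -fps_binomMn fps_binom_dffact //.
  by rewrite mulrC divfK ?fact_neq0.
pose u j := 'C(k, j)%:R * (g ^+ j)`[n].
have -> : ((1 + g) ^+ k)`[n] = \sum_(j < n.+1) u j.
  rewrite addrC exprD1n fcoef_sum.
  transitivity (\sum_(j < k.+1) u j).
    by apply: eq_bigr => j _; rewrite fcoefMn /u mulr_natl.
  (* Both sums may be run up to [n + k]: the extra terms vanish because
     [g ^+ j] has order at least [j] in one case and ['C(k, j) = 0] in the other. *)
  rewrite (big_ord_widen (n + k).+1 u) ?ltnS ?leq_addl //.
  rewrite [RHS](big_ord_widen (n + k).+1 u) ?ltnS ?leq_addr //.
  rewrite big_mkcond [RHS]big_mkcond; apply: eq_bigr => j _.
  case: ltnP => jk; case: ltnP => jn //.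
    by rewrite /u fcoef_exp_gt ?mulr0 ?deg_exp_coef0.
  by rewrite /u bin_small ?mul0r.
rewrite mulr_sumr; apply: eq_bigr => j _.
rewrite ffact_natr -bin_ffact natrM /u.
by have := fact_neq0 F j => ?; field.
Qed.

Lemma egf_coef_comp (f : fps F) n :
  egf_coef (fps_comp f g) n = \sum_(m < n.+1) egf_coef f m * S2 n m.
Proof.
rewrite /egf_coef [in LHS]/= mulr_sumr; apply: eq_bigr => m _.
by rewrite mulrCA -stirling2_egf -1?ltnS // mulrA [f`[m] * _]mulrC.
Qed.

Lemma fps_comp_binom (y : F) :
  fps_comp (fps_binom 1 y) g = fps_binom lam (y / lam).
Proof.
apply: fpsP => n; apply: (mulfI (fact_neq0 F n)).
rewrite -[LHS]/(egf_coef _ n) egf_coef_comp fps_binom_dffact //.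
rewrite [RHS]mulrC divfK ?fact_neq0 // dffact_stirling2.
apply: eq_bigr => m _; rewrite mulrC; congr (_ * _).
by rewrite /egf_coef /= expr1n mulr1 mulrC divfK ?fact_neq0.
Qed.

(** Multiplying by [g], which is not a unit but can be cancelled, turns both
    sides into [t * (1 + lam t)^(x/lam)]: on the left this is the image of
    [log_lam (1 + t) * (1 + t)^x] under the substitution. *)
Lemma fps_comp_daehee (x : F) :
  fps_comp (fps_quot (deg_log lam) fpsX * fps_binom 1 x) g
  = fps_quot fpsX g * fps_binom lam (x / lam).
Proof.
apply/eqP; rewrite -subr_eq0; apply/eqP.
apply: fps_mul_eq0 deg_exp_neq0; rewrite mulrBl.
apply/eqP; rewrite subr_eq0 mulrC -fps_compXM ?deg_exp_coef0 //; apply/eqP.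
rewrite mulrA [fpsX * _]mulrC deg_daehee_quotK.
rewrite [RHS]mulrAC (deg_bernoulli_quotK lam0) /deg_log -mulrA mulrBl mul1r.
rewrite -fps_binomD fps_compCM fps_compB !fps_comp_binom mulrDl divff //.
rewrite fps_binomD fps_binom_1 mulrDl mul1r addrC addKr !mulrA.
suff -> : fpsC lam^-1 * fpsC lam = 1 :> fps F by rewrite mul1r.
by apply: fpsP => n; rewrite fcoefCM /=; case: n => [|n]; rewrite ?mulVf ?mulr0.
Qed.

End Stirling.

Theorem theorem2p2 (R : realType) (lam x : R) (hlam : lam != 0)
    (S2 : nat -> nat -> R) (hS2 : is_deg_stirling2 lam S2) (n : nat) :
  deg_bernoulli lam x n = \sum_(m < n.+1) deg_daehee lam x m * S2 n m.
Proof.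
by rewrite /deg_bernoulli -(fps_comp_daehee hlam hS2) (egf_coef_comp hlam hS2).
Qed.
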